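(* Let $H$ be a finite graph, $k\geq1$, $\tilde{A}_H=I_k\otimes A_H$, and let $\tilde M=I_k\otimes M_{\hat\pi}$, where $M_{\hat\pi}$ is the characteristic matrix of the neighborhood partition of $V_H$; put $\tilde{A}_H/\hat\pi=\tilde M^T\tilde{A}_H\tilde M$. If $\tilde{A}_H/\hat\pi$ is invertible and $P$ is a permutation matrix of size $k|V_H|$ such that $\tilde{A}_HP\tilde{A}_H$ is symmetric, then there exists a permutation matrix $Q$ of size $k|V_H|$ with $Q^2=I$ (equivalently $Q=Q^T$) such that $\tilde{A}_HP\tilde{A}_H=\tilde{A}_HQ\tilde{A}_H$.
   Context: Graphs are finite and undirected; loops and multiple edges allowed; $A_H$ is the adjacency matrix (entries count edges). The neighborhood partition $\hat\pi$ of $V_H$ puts $v,w$ in the same part iff they have the same set of neighbors. For a partition $\{C_1,\ldots,C_m\}$ of an $n$-element vertex set, the characteristic matrix is the $n\times m$ matrix with entry $1/\sqrt{|C_i|}$ in position $(v,i)$ if $v\in C_i$ and $0$ otherwise.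
   Formalization: In the neighborhood partition, two vertices are in the same part iff they have the same neighbors counted with edge multiplicity (same as sets when there are no multiple edges); with plain neighbor sets the claim fails for multigraphs, e.g. A = aa^T, a = (1,2,4)^T. *)

(* Defs.v *)
From HB Require Import structures.
From mathcomp Require Import all_boot all_order all_algebra.
From mathcomp.real_closed Require Export mxtens.

Set Implicit Arguments.
Unset Strict Implicit.
Unset Printing Implicit Defensive.

Import Order.TTheory GRing.Theory Num.Theory.
Local Open Scope ring_scope.

(* Edges are unlabelled: a finite undirected multigraph is its table of edge
   multiplicities. [nedges u u] is the number of loops at [u], each counted
   once. *)
Record multigraph := Multigraph {
  vertex :> finType;
  nedges : vertex -> vertex -> nat;
  nedgesC : forall u v, nedges u v = nedges v u
}.

Definition adjmx (R : rcfType) (H : multigraph) : 'M[R]_#|H| :=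
  \matrix_(i, j) (nedges (enum_val i : H) (enum_val j : H))%:R.

(* Neighbors are counted with multiplicity, i.e. the neighborhood of [v] is a
   multiset, given by its multiplicity function. Without multiple edges this
   is the ordinary set of neighbors (neighborhood_partition_simple below). With
   multiple edges, forgetting multiplicities would give a different partition,
   for which quotients lose information: for three vertices with
   A = a a^T, a = (1,2,4)^T, all vertices would be in one part and the quotient
   would be the invertible 1 x 1 matrix (49/3); for P a 3-cycle,
   A P A = (a^T P a) A = 14 A is symmetric, whereas a^T Q a is one of
   21, 20, 17, 12 for an involution Q. *)
Definition neighborhood (H : multigraph) (v : H) : {ffun H -> nat} :=
  [ffun w => nedges v w].

Definition neighborhood_partition (H : multigraph) : {set {set H}} :=
  preim_partition (@neighborhood H) [set: H].

Definition charmx (R : rcfType) (V : finType) (C : {set {set V}}) :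
    'M[R]_(#|V|, #|C|) :=
  \matrix_(i, j) if enum_val i \in (enum_val j : {set V})
                 then (Num.sqrt #|(enum_val j : {set V})|%:R)^-1 else 0.

Definition tadjmx (R : rcfType) (k : nat) (H : multigraph) :
    'M[R]_(k * #|H|) :=
  1%:M *t adjmx R H.

Definition tcharmx (R : rcfType) (k : nat) (H : multigraph) :
    'M[R]_(k * #|H|, k * #|neighborhood_partition H|) :=
  1%:M *t charmx R (neighborhood_partition H).

Definition tquomx (R : rcfType) (k : nat) (H : multigraph) :
    'M[R]_(k * #|neighborhood_partition H|) :=
  (tcharmx R k H)^T *m tadjmx R k H *m tcharmx R k H.

Definition neighbor_set (H : multigraph) (v : H) : {set H} :=
  [set w | (0 < nedges v w)%N].

Lemma neighborhood_partition_simple (H : multigraph) :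
  (forall u v : H, (nedges u v <= 1)%N) ->
  neighborhood_partition H = preim_partition (@neighbor_set H) [set: H].
Proof.
move=> le1; apply: eq_imset => u; apply/setP=> v; rewrite !inE.
apply/eqP/eqP => [/ffunP E | /setP E].
  by apply/setP=> w; move: (E w); rewrite !ffunE !inE => ->.
apply/ffunP=> w; move: (E w) (le1 u w) (le1 v w); rewrite !ffunE !inE.
by case: (nedges u w) (nedges v w) => [|[|?]] [|[|?]].
Qed.

(* Main.v *)
Require Import Defs.
From mathcomp Require Import all_boot all_order all_algebra all_fingroup.
Import Order.TTheory GRing.Theory Num.Theory.
Local Open Scope ring_scope.

(** Write [A], [M] for the tensored matrices. Since [A] is constant on the parts,
    [M M^T A = A = A M M^T], so invertibility of [M^T A M] turns the symmetry of
    [A P A] into that of [M^T P M]: for any parts [c], [d], the permutation sends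
    as many elements of [c] into [d] as of [d] into [c]. Exchanging these two
    sets of elements, for all [c] and [d], defines an involution [Q] with
    [Q M = P M], whence [A Q A = A Q M M^T A = A P A]. *)

Lemma involution_of_balanced (T : finType) (L : eqType) (f : T -> L)
    (s : {perm T}) :
  (forall c d, #|[set x | (f x == c) && (f (s x) == d)]|
             = #|[set x | (f x == d) && (f (s x) == c)]|) ->
  exists t : {perm T}, involutive t /\ forall x, f (t x) = f (s x).
Proof.
move=> balanced; pose S c d := [set x | (f x == c) && (f (s x) == d)].
(* The [i]-th element of [S c d] is exchanged with the [i]-th one of [S d c];
   the elements of [S c c] are fixed. *)
pose g x := nth x (enum (S (f (s x)) (f x))) (index x (enum (S (f x) (f (s x))))).
have memS x : x \in S (f x) (f (s x)) by rewrite inE !eqxx.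
have ltS x : (index x (enum (S (f x) (f (s x)))) < size (enum (S (f (s x)) (f x))))%N.
  by rewrite -cardE balanced cardE index_mem mem_enum memS.
have gS x : g x \in S (f (s x)) (f x) by rewrite -mem_enum mem_nth.
have fg x : f (g x) = f (s x) by move: (gS x); rewrite inE => /andP[/eqP].
have fsg x : f (s (g x)) = f x by move: (gS x); rewrite inE => /andP[_ /eqP].
have gK : involutive g.
  (* By [fg] and [fsg], the two label sets swap roles at [g x], whose index is that of [x]. The
     outer [nth] has default [g x], replaceable by [x] as the index is in range. *)
  move=> x; rewrite {1}/g fg fsg index_uniq ?enum_uniq //.
  by rewrite (set_nth_default x) ?nth_index ?index_mem ?mem_enum ?memS.
exists (perm (can_inj gK)); split=> x; first by rewrite !permE gK.
by rewrite permE fg.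
Qed.

(** An arbitrary label map [f] and weights [w] stand for the partition, so that the tensored
    matrices are a direct instance. *)
Lemma involution_of_symmetric_quotient (R : numFieldType) (n m : nat)
    (f : 'I_n -> 'I_m) (w : 'I_m -> R) (A : 'M[R]_n) (M : 'M[R]_(n, m))
    (s : 'S_n) :
    (forall c, w c != 0) -> (forall i c, M i c = if f i == c then w c else 0) ->
    A^T = A -> M *m M^T *m A = A -> M^T *m A *m M \in unitmx ->
    (A *m perm_mx s *m A)^T = A *m perm_mx s *m A ->
  exists2 t : 'S_n, involutive t
    & A *m perm_mx s *m A = A *m perm_mx t *m A.
Proof.
move=> w_neq0 ME AT MMA unitB symAPA.
have AMM : A *m M *m M^T = A by apply: trmx_inj; rewrite !trmx_mul trmxK AT mulmxA.
set B := M^T *m A *m M in unitB.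
pose X := M^T *m perm_mx s *m M.
have BT : B^T = B by rewrite /B !trmx_mul trmxK AT mulmxA.
have BXB : B *m X *m B = M^T *m (A *m perm_mx s *m A) *m M.
  have -> : B *m X *m B
      = M^T *m (A *m M *m M^T) *m perm_mx s *m (M *m M^T *m A) *m M.
    by rewrite !mulmxA.
  by rewrite AMM MMA !mulmxA.
have symBXB : (B *m X *m B)^T = B *m X *m B.
  by rewrite BXB 2!trmx_mul trmxK symAPA mulmxA.
(* [B X B] and its transpose [B X^T B] agree; the unit [B] cancels on both sides. *)
have XT : X^T = X.
  apply: (can_inj (mulKmx unitB)); apply: (can_inj (mulmxK unitB)).
  by rewrite -[RHS]symBXB (trmx_mul (B *m X)) (trmx_mul B) BT mulmxA.
(* The factor [w c * w d] is symmetric and nonzero, so the symmetry of [X] passes to the counts,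
   first in [R], then in [nat] since the characteristic is 0. *)
have XE c d : X c d = #|[set i | (f i == c) && (f (s i) == d)]|%:R * (w c * w d).
  rewrite /X -mulmxA -row_permE mxE mulr_natl -sumr_const big_mkcond /=.
  rewrite [RHS]big_mkcond /=; apply: eq_bigr => i _; rewrite !mxE !ME inE.
  by do 2!case: eqP; rewrite ?mul0r ?mulr0.
have balanced c d : #|[set i | (f i == c) && (f (s i) == d)]|
                  = #|[set i | (f i == d) && (f (s i) == c)]|.
  have : X c d = X d c by rewrite -[in LHS]XT mxE.
  rewrite !XE (mulrC (w d)) => /(mulIf (mulf_neq0 (w_neq0 c) (w_neq0 d)))/eqP.
  by rewrite eqr_nat => /eqP.
have [t [tK ft]] := involution_of_balanced _ _ f s balanced.
exists t => //.
(* Row [i] of either side is determined by the label of the image of [i]. *)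
have PM : perm_mx s *m M = perm_mx t *m M.
  by rewrite -!row_permE; apply/matrixP=> i c; rewrite !mxE !ME ft.
(* [A u A] depends on [u] only through [u M]. *)
have insertM u : A *m u *m A = A *m (u *m M) *m (M^T *m A).
  by rewrite !mulmxA -(mulmxA _ M M^T) -(mulmxA _ (M *m M^T) A) MMA.
by rewrite insertM PM -insertM.
Qed.

Lemma neighborhood_partitionP (H : multigraph) :
  partition (neighborhood_partition H) [set: H].
Proof. exact: preim_partitionP. Qed.

(** The parts cover and are disjoint, so the label of a vertex is the rank of its block. *)
Lemma partition_label (V : finType) (C : {set {set V}}) :
  partition C [set: V] ->
  exists f : 'I_#|V| -> 'I_#|C|,
    forall i c, (enum_val i \in (enum_val c : {set V})) = (f i == c).
Proof.
case/and3P=> /eqP covC tiC _; apply: (fin_all_exists (P := fun i j => forall c,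
  (enum_val i \in (enum_val c : {set V})) = (j == c))) => i.
have blockC : pblock C (enum_val i) \in C by rewrite pblock_mem ?covC ?inE.
exists (enum_rank_in blockC (pblock C (enum_val i))) => c.
apply/idP/eqP => [iC | <-].
  by apply: enum_val_inj; rewrite enum_rankK_in // (def_pblock tiC (enum_valP c)).
by rewrite enum_rankK_in // mem_pblock covC inE.
Qed.

Lemma adjmx_sym (R : rcfType) (H : multigraph) : (adjmx R H)^T = adjmx R H.
Proof. by apply/matrixP=> i j; rewrite !mxE nedgesC. Qed.

Lemma charmx_weight_neq0 (R : rcfType) (V : finType) (C : {set {set V}})
    (c : 'I_#|C|) : partition C [set: V] ->
  (Num.sqrt #|(enum_val c : {set V})|%:R)^-1 != 0 :> R.
Proof.
case/and3P=> _ _ C0; rewrite invr_eq0 sqrtr_eq0 -ltNge ltr0n card_gt0.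
by apply: contraNneq C0 => <-; exact: enum_valP.
Qed.

(** [M M^T] averages over each part, and vertices with the same neighborhood have equal rows in the
    adjacency matrix. *)
Lemma charmx_proj_adjmx (R : rcfType) (H : multigraph) :
  let M := charmx R (neighborhood_partition H) in
  M *m M^T *m adjmx R H = adjmx R H.
Proof.
move=> M; have partC := neighborhood_partitionP H.
have [f fE] := partition_label _ _ partC.
pose w (c : 'I_#|neighborhood_partition H|) : R :=
  (Num.sqrt #|(enum_val c : {set H})|%:R)^-1.
have ME i c : M i c = if f i == c then w c else 0 by rewrite mxE fE.
clearbody M.
have MME i j : (M *m M^T) i j = if f j == f i then w (f i) ^+ 2 else 0.
  rewrite mxE (bigD1 (f i)) //= big1 ?addr0 => [|c /negPf neq].
    by rewrite mxE !ME eqxx; case: ifP; rewrite ?mulr0.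
  by rewrite ME eq_sym neq mul0r.
have AE i j l : f j = f i -> adjmx R H j l = adjmx R H i l.
  move/eqP; rewrite -fE => ji; have := fE i (f i); rewrite eqxx => ii.
  have /imsetP[x _ Ex] := enum_valP (f i).
  move: ii ji; rewrite Ex !inE => /eqP-> /eqP/ffunP/(_ (enum_val l)).
  by rewrite !ffunE !mxE => ->.
have cardE c : #|[pred j | f j == c]| = #|(enum_val c : {set H})|.
  rewrite -[RHS](on_card_preimset (f := @enum_val H predT)).
    by apply: eq_card => j; rewrite !inE fE.
  exact/onW_bij/enum_val_bij.
apply/matrixP=> i l; rewrite mxE.
(* The sum has one equal term per vertex of the part, each weighted by the inverse of its size. *)
rewrite (eq_bigr (fun j => if f j == f i then w (f i) ^+ 2 * adjmx R H i l else 0)).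
  rewrite -big_mkcond sumr_const cardE -mulrnAl -[_ *+ _]mulr_natr exprVn.
  rewrite sqr_sqrtr ?ler0n // mulVf ?mul1r // pnatr_eq0 -lt0n.
  by apply/card_gt0P; exists (enum_val i); rewrite fE.
by move=> j _; rewrite MME; case: eqP => [/AE-> | _]; rewrite ?mul0r.
Qed.

Theorem theorem4p13 (R : rcfType) (H : multigraph) (k : nat) (hk : (1 <= k)%N)
    (hinv : tquomx R k H \in unitmx)
    (P : 'M[R]_(k * #|H|)) (hP : is_perm_mx P)
    (hsym : (tadjmx R k H *m P *m tadjmx R k H)^T
            = tadjmx R k H *m P *m tadjmx R k H) :
  exists Q : 'M[R]_(k * #|H|),
    [/\ is_perm_mx Q,
        Q *m Q = 1%:M
      & tadjmx R k H *m P *m tadjmx R k H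
        = tadjmx R k H *m Q *m tadjmx R k H].
Proof.
have partC := neighborhood_partitionP H.
have [f fE] := partition_label _ _ partC.
have [s defP] := is_perm_mxP _ hP; subst P.
(* The tensored matrix describes [k] disjoint copies of [H]: a label records the copy and the part,
   a weight only the part. *)
pose tf (i : 'I_(k * #|H|)) := let: (a, v) := mxtens_unindex i in mxtens_index (a, f v).
pose w (c : 'I_(k * #|neighborhood_partition H|)) : R :=
  (Num.sqrt #|(enum_val (mxtens_unindex c).2 : {set H})|%:R)^-1.
have [||||t tK ->] :=
  @involution_of_symmetric_quotient R _ _ tf w (tadjmx R k H) (tcharmx R k H)
    s _ _ _ _ hinv hsym.
- by move=> c; apply: charmx_weight_neq0.
- move=> i c; case: (mxtens_indexP i) => a v; case: (mxtens_indexP c) => b d.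
  rewrite tensmxE !mxE fE /tf /w !mxtens_indexK.
  rewrite (can_eq (@mxtens_indexK _ _)) xpair_eqE /=.
  by do 2!case: eqP; rewrite ?mul1r ?mul0r ?mulr0.
- by rewrite trmx_tens trmx1 adjmx_sym.
- by rewrite trmx_tens !tensmx_mul trmx1 !mul1mx charmx_proj_adjmx.
exists (perm_mx t); split=> //; first exact: perm_mx_is_perm.
rewrite -perm_mxM -perm_mx1; congr perm_mx.
by apply/permP=> x; rewrite permM perm1 tK.
Qed.
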